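(* Let $k\ge 2$ be an integer, and let $\Lambda_{\mathrm{opt}}:\mathbb{R}^{k-1}\to[0,\infty)$ be the kernel defined in the context (for some fixed $\beta>0$). Let $\Lambda:\mathbb{R}^{k-1}\to\mathbb{R}$ be any nonnegative (measurable) kernel with $\int_{\mathbb{R}^{k-1}}\Lambda(\omega)\,d\omega=1$ that satisfies all the necessary symmetries, i.e. for every $\sigma\in S_k$, writing $\rho(\sigma)'=(b_{i,j})$ for the transpose of $\rho(\sigma)$, $$\Lambda(\omega_1,\dots,\omega_{k-1})=\Lambda\left(\sum_{j=1}^{k-1}b_{1,j}\omega_j,\ \dots,\ \sum_{j=1}^{k-1}b_{k-1,j}\omega_j\right)\qquad\text{for all }(\omega_1,\dots,\omega_{k-1})\in\mathbb{R}^{k-1}.$$ Also assume that $$\int_{\mathbb{R}^{k-1}}\omega_j^2\,\Lambda(\omega)\,d\omega=\int_{\mathbb{R}^{k-1}}\omega_j^2\,\Lambda_{\mathrm{opt}}(\omega)\,d\omega\qquad\text{for } j=1,\dots,k-1.$$ Then $\|\Lambda\|_{L_2}\ge\|\Lambda_{\mathrm{opt}}\|_{L_2}$, i.e. $$\int_{\mathbb{R}^{k-1}}\Lambda(\omega)^2\,d\omega\ \ge\ \int_{\mathbb{R}^{k-1}}\Lambda_{\mathrm{opt}}(\omega)^2\,d\omega.$$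
   Context: Definition of $\Lambda_{\mathrm{opt}}$: fix any constant $\beta>0$ and put $$\tilde\Lambda_{\mathrm{opt}}(\omega_1,\dots,\omega_{k-1})=\alpha\left(1-\beta\left(\sum_{i=1}^{k-1}\omega_i^2+\sum_{1\le i<j\le k-1}\omega_i\omega_j\right)\right),\qquad \Lambda_{\mathrm{opt}}(\omega)=\max\big(\tilde\Lambda_{\mathrm{opt}}(\omega),0\big),$$ where $\alpha>0$ is chosen such that $\int_{\mathbb{R}^{k-1}}\Lambda_{\mathrm{opt}}(\omega)\,d\omega=1$. Definition of $\rho$: $S_k$ is the group of permutations of $\{1,\dots,k\}$. A permutation $\sigma\in S_k$ acts on a vector $v=(v_1,\dots,v_k)\in\mathbb{R}^k$ by moving the entry in position $i$ to position $\sigma(i)$, i.e. $(\sigma v)_{\sigma(i)}=v_i$. Let $\psi:\mathbb{R}^k\to\mathbb{R}^{k-1}$ be given by $\psi(x_1,x_2,\dots,x_k)=(x_2-x_1,\dots,x_k-x_1)$. For $\sigma\in S_k$, $\rho(\sigma)=(a_{i,j})$ is the $(k-1)\times(k-1)$ real matrix such that, for all $(x_1,\dots,x_{k-1})\in\mathbb{R}^{k-1}$, the $i$-th coordinate of $\psi\big(\sigma(0,x_1,\dots,x_{k-1})\big)$ equals $\sum_{j=1}^{k-1}a_{i,j}x_j$. For example, for $k=3$ and $\sigma=(12)$: $(0,x,y)\mapsto(x,0,y)\mapsto(-x,y-x)$, so $\rho(\sigma)=\begin{pmatrix}-1&0\\-1&1\end{pmatrix}$ and the corresponding symmetry is $\Lambda(\omega_1,\omega_2)=\Lambda(-\omega_1-\omega_2,\omega_2)$.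 *)

(* Defs.v *)
From HB Require Import structures.
From mathcomp Require Import all_boot all_order all_algebra perm.
From mathcomp Require Import all_classical all_reals all_analysis.

Set Implicit Arguments.
Unset Strict Implicit.
Unset Printing Implicit Defensive.
Import Order.TTheory GRing.Theory Num.Theory.
Import numFieldNormedType.Exports.

Local Open Scope classical_set_scope.
Local Open Scope ring_scope.

(* Points of R^n are [n.-tuple R]; the library gives tuples the product
   sigma-algebra but no product measure, which is built here by recursion. *)

Section cons_measure.
Context {d : measure_display} {T : measurableType d} {R : realType} {n : nat}.

Definition cons_pair (p : T * n.-tuple T) : n.+1.-tuple T :=
  [tuple of p.1 :: p.2].

Definition uncons_pair (x : n.+1.-tuple T) : T * n.-tuple T :=
  (thead x, [tuple of behead x]).

Lemma cons_pairK : cancel cons_pair uncons_pair.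
Proof.
by case=> x y; rewrite /uncons_pair /= theadE; congr pair; exact: val_inj.
Qed.

Lemma measurable_cons_pair : measurable_fun [set: T * n.-tuple T] cons_pair.
Proof. exact: (measurable_cons measurable_fst measurable_snd). Qed.

Lemma measurable_uncons_pair : measurable_fun [set: n.+1.-tuple T] uncons_pair.
Proof.
apply: measurable_fun_pair; last exact: measurable_behead.
exact: (measurable_tnth (T := T) ord0).
Qed.

Variable m1 : {sigma_finite_measure set T -> \bar R}.
Variable m2 : {sigma_finite_measure set (n.-tuple T) -> \bar R}.

Definition cons_measure : set (n.+1.-tuple T) -> \bar R :=
  pushforward (m1 \x m2)%E cons_pair.

Let cons_measure0 : cons_measure set0 = 0%E.
Proof. by rewrite /cons_measure /pushforward preimage_set0 measure0. Qed.

Let cons_measure_ge0 A : (0 <= cons_measure A)%E.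
Proof. by rewrite /cons_measure /pushforward; exact: measure_ge0. Qed.

Let cons_measure_sigma_additive : semi_sigma_additive cons_measure.
Proof.
move=> F mF tF mUF; rewrite /cons_measure /pushforward preimage_bigcup.
apply: measure_semi_sigma_additive.
- by move=> k; rewrite -[X in measurable X]setTI; exact: measurable_cons_pair.
- apply/trivIsetP => /= i j _ _ ij; rewrite -preimage_setI.
  by move/trivIsetP : tF => /(_ _ _ _ _ ij) ->//; rewrite preimage_set0.
- rewrite -preimage_bigcup -[X in measurable X]setTI.
  exact: measurable_cons_pair.
Qed.

HB.instance Definition _ := isMeasure.Build _ _ _ cons_measure
  cons_measure0 cons_measure_ge0 cons_measure_sigma_additive.

Let cons_measure_sigma_finite : sigma_finite setT cons_measure.
Proof.
have /sigma_finiteP[F [TF ndF Foo]] := sigma_finiteT m1.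
have /sigma_finiteP[G [TG ndG Goo]] := sigma_finiteT m2.
exists (fun k => uncons_pair @^-1` (F k `*` G k)).
  rewrite -preimage_bigcup; apply/esym/seteqP; split => // x _ /=.
  have [j _ Fj] : (\bigcup_k F k) (uncons_pair x).1 by rewrite -TF.
  have [k _ Gk] : (\bigcup_k G k) (uncons_pair x).2 by rewrite -TG.
  exists (maxn j k) => //; split.
  - by move: Fj; exact/subsetPset/ndF/leq_maxl.
  - by move: Gk; exact/subsetPset/ndG/leq_maxr.
move=> k; have [mF Fk] := Foo k; have [mG Gk] := Goo k; split.
  rewrite -[X in measurable X]setTI.
  by apply: measurable_uncons_pair => //; exact: measurableX.
rewrite /cons_measure /pushforward -comp_preimage.
rewrite (_ : _ \o _ = id); last by apply/funext => p; exact: cons_pairK.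
by rewrite product_measure1E// lte_mul_pinfty// ge0_fin_numE.
Qed.

HB.instance Definition _ := Measure_isSigmaFinite.Build _ _ _ cons_measure
  cons_measure_sigma_finite.

End cons_measure.

Fixpoint power_measure (d : measure_display) (T : measurableType d)
    (R : realType) (m : {sigma_finite_measure set T -> \bar R}) (n : nat) :
    {sigma_finite_measure set (n.-tuple T) -> \bar R} :=
  match n with
  | 0 => @dirac _ (0.-tuple T) [tuple] R
  | n'.+1 => cons_measure m (power_measure m n')
  end.

Lemma power_measure_box (d : measure_display) (T : measurableType d)
    (R : realType) (m : {sigma_finite_measure set T -> \bar R}) (n : nat)
    (A : 'I_n -> set T) : (forall i, measurable (A i)) ->
  power_measure m n [set x | forall i, A i (tnth x i)] =
  (\prod_(i < n) m (A i))%E.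
Proof.
elim: n A => [|n IH] A mA.
  by rewrite big_ord0 /= diracE mem_set//= => -[].
rewrite big_ord_recl -IH => [|i]; last exact: mA.
rewrite -product_measure1E//; last first.
  rewrite (_ : [set x | _] = \big[setI/setT]_(i <- index_enum 'I_n)
      ((fun x : n.-tuple T => tnth x i) @^-1` A (lift ord0 i))).
    apply: bigsetI_measurable => i _; rewrite -[X in measurable X]setTI.
    by apply: measurable_tnth.
  rewrite -bigcap_seq; apply/seteqP; split=> x /= h i; first by move=> _.
  by apply: h; exact: mem_index_enum.
congr (product_measure1 _ _ _).
apply/seteqP; split=> -[x y] /=.
  move=> h; split; first exact: (h ord0).
  by move=> i; have := h (lift ord0 i); rewrite tnthS.
move=> [hx hy] i; case: (unliftP ord0 i) => [j ->|->] //.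
by rewrite tnthS.
Qed.

Section lebesgue_measure_on_Rn.
Context (R : realType) (n : nat).

Definition borel_lebesgue :
    {sigma_finite_measure set (n.-tuple (measurableTypeR R)) -> \bar R} :=
  power_measure (@lebesgue_measure R) n.

(* R^n with the sigma-algebra of Lebesgue (not only Borel) measurable sets:
   the completion of the Borel sigma-algebra. *)
Definition Rn := caratheodory_type (borel_lebesgue^*)%mu.

HB.instance Definition _ := Measurable.on Rn.

Definition lebesgue_Rn : {measure set Rn -> \bar R} :=
  @completed_measure_extension _ _ _ borel_lebesgue.

Lemma lebesgue_Rn_borel (A : set (n.-tuple (measurableTypeR R))) :
  measurable A ->
  measurable (A : set Rn) /\ lebesgue_Rn A = borel_lebesgue A.
Proof.
move=> mA; split; first exact: caratheodory_measurable_mu_ext.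
exact: measurable_mu_extE.
Qed.

End lebesgue_measure_on_Rn.

Section kernel.
Context {R : realType} {n : nat}.

Definition Lambda_opt_tilde (alpha beta : R) (w : n.-tuple R) : R :=
  alpha * (1 - beta * (\sum_(i < n) tnth w i ^+ 2 +
                       \sum_(i < n) \sum_(j < n | (i < j)%N)
                         tnth w i * tnth w j)).

Definition Lambda_opt (alpha beta : R) (w : n.-tuple R) : R :=
  Num.max (Lambda_opt_tilde alpha beta w) 0.

End kernel.

Section symmetries.
Context {R : realType}.

(* The entry in position [i] moves to position [s i]. *)
Definition perm_act (k : nat) (s : 'S_k) (v : k.-tuple R) : k.-tuple R :=
  [tuple tnth v ((s^-1)%g i) | i < k].

Lemma perm_actE (k : nat) (s : 'S_k) (v : k.-tuple R) (i : 'I_k) :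
  tnth (perm_act s v) (s i) = tnth v i.
Proof. by rewrite tnth_mktuple permK. Qed.

Definition psi (n : nat) (x : n.+1.-tuple R) : n.-tuple R :=
  [tuple tnth x (lift ord0 i) - tnth x ord0 | i < n].

Definition cons0 (n : nat) (x : n.-tuple R) : n.+1.-tuple R :=
  [tuple of 0 :: x].

Definition unit_tuple (n : nat) (j : 'I_n) : n.-tuple R :=
  [tuple (i == j)%:R | i < n].

(* The matrix of the linear map [x |-> psi (s (0, x))], characterised by
   [rhoP] and [rho_unique]. *)
Definition rho (n : nat) (s : 'S_n.+1) : 'M[R]_n :=
  \matrix_(i, j) tnth (psi (perm_act s (cons0 (unit_tuple j)))) i.

Lemma cons0_sum (n : nat) (x : n.-tuple R) (i : 'I_n.+1) :
  tnth (cons0 x) i = \sum_(j < n) tnth (cons0 (unit_tuple j)) i * tnth x j.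
Proof.
case: (unliftP ord0 i) => [i' ->|->].
  rewrite tnthS (bigD1 i') //= tnthS tnth_mktuple eqxx mul1r big1 ?addr0//.
  by move=> j jE; rewrite tnthS tnth_mktuple eq_sym (negbTE jE) mul0r.
by rewrite big1 // => j _; rewrite tnth0 mul0r.
Qed.

Lemma rhoP (n : nat) (s : 'S_n.+1) (x : n.-tuple R) (i : 'I_n) :
  tnth (psi (perm_act s (cons0 x))) i = \sum_(j < n) rho s i j * tnth x j.
Proof.
rewrite !tnth_mktuple (cons0_sum x) [X in _ - X]cons0_sum -sumrB.
by apply: eq_bigr => j _; rewrite !mxE !tnth_mktuple mulrBl.
Qed.

Lemma rho_unique (n : nat) (s : 'S_n.+1) (A : 'M[R]_n) :
  (forall (x : n.-tuple R) (i : 'I_n),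
    tnth (psi (perm_act s (cons0 x))) i = \sum_(j < n) A i j * tnth x j) ->
  A = rho s.
Proof.
move=> AP; apply/matrixP => i j; rewrite [RHS]mxE AP (bigD1 j) //=.
rewrite tnth_mktuple eqxx mulr1 big1 ?addr0// => l lj.
by rewrite tnth_mktuple (negbTE lj) mulr0.
Qed.

Definition mx_act (n : nat) (B : 'M[R]_n) (w : n.-tuple R) : n.-tuple R :=
  [tuple \sum_(j < n) B i j * tnth w j | i < n].

End symmetries.

(* Main.v *)
Require Import Defs.
From HB Require Import structures.
From mathcomp Require Import all_boot all_order all_algebra perm.
From mathcomp Require Import all_classical all_reals all_analysis.
From mathcomp Require Import measurable_realfun ring lra.

(* Write w_0 = - (w_1 + ... + w_n) and let q be the quadratic form in the
   definition of Lambda_opt, so that 2 q = w_0^2 + w_1^2 + ... + w_n^2.  The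
   transposition (0 1) acts through rho by exchanging w_0 and w_1, and this map
   preserves Lebesgue measure; hence the symmetry of Lambda makes its moment of
   w_0^2 equal to that of w_1^2, and the prescribed moments determine the
   integral of q * Lambda.  With f = Lambda_opt, the pointwise inequality
   2 alpha Lambda <= Lambda^2 + f^2 + 2 alpha beta q Lambda, which is an
   equality for Lambda = f, then gives the claim after integration. *)

Set Implicit Arguments.
Unset Strict Implicit.
Unset Printing Implicit Defensive.
Import Order.TTheory GRing.Theory Num.Theory.
Import numFieldNormedType.Exports.

Local Open Scope classical_set_scope.
Local Open Scope ring_scope.

(** * Measure-preserving maps on the line and on products *)

Lemma lebesgue_measure_reflection (R : realType) (c : R) (A : set R) :
  measurable A ->
  pushforward lebesgue_measure (fun x => c - x : measurableTypeR R) A =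
  lebesgue_measure A.
Proof.
have mf : measurable_fun [set: measurableTypeR R]
    (fun x : measurableTypeR R => c - x : measurableTypeR R).
  exact: measurable_funB.
pose mphi := isMeasurableFun.Build _ _ _ _ _ mf.
pose phi : {mfun measurableTypeR R >-> measurableTypeR R} :=
  HB.pack (fun x : measurableTypeR R => c - x : measurableTypeR R) mphi.
move=> mA; rewrite -[LHS]/(pushforward lebesgue_measure phi A).
(* It suffices to compare the measures on the intervals []a, b]], whose preimages [[c - b, c - a[]
   have the same length. *)
apply/esym/lebesgue_measure_unique => // _ [[a b]] _ <-.
rewrite -[RHS]/(lebesgue_measure ((fun x => c - x) @^-1` `]a, b])).
rewrite (_ : _ @^-1` _ = `[c - b, c - a[%classic); last first.
  apply/seteqP; split => x /=; rewrite !in_itv/= => /andP[? ?];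
    by apply/andP; split; lra.
rewrite !lebesgue_measure_itv/= !lte_fin ltrD2l ltrN2.
by case: ifP => // _; rewrite -!EFinB; congr EFin; lra.
Qed.

(** By uniqueness, the product measure may be computed by integrating over the second factor first
    fixed; for each [y], the section of the preimage is the preimage of the section under
    [f (_, y)], of equal measure. *)
Lemma product_measure_skew (d1 d2 : measure_display) (T1 : measurableType d1)
    (T2 : measurableType d2) (R : realType)
    (m1 : {sigma_finite_measure set T1 -> \bar R})
    (m2 : {sigma_finite_measure set T2 -> \bar R}) (f : T1 * T2 -> T1) :
    measurable_fun [set: T1 * T2] f ->
    (forall y A, measurable A ->
      pushforward m1 (fun x => f (x, y)) A = m1 A) ->
  forall A, measurable A ->
    pushforward (m1 \x m2)%E (fun p => (f p, p.2)) A = (m1 \x m2)%E A.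
Proof.
move=> mf f_inv A mA.
have m12 B : measurable B -> (m1 \x m2)%E B = (m1 \x^ m2)%E B.
  apply: product_measure_unique => C D mC mD; exact: product_measure2E.
rewrite /pushforward !m12//; last first.
  rewrite -[X in measurable X]setTI.
  by apply: (measurable_fun_pair mf measurable_snd).
rewrite /product_measure2/=; apply: eq_integral => y _ /=.
by rewrite -(f_inv y (ysection A y))//; exact: measurable_ysection.
Qed.

(** * Measure-preserving involutions and the completed measure *)

Section completion.
Context (d : measure_display) (T : measurableType d) (R : realType).
Variables (mu : {measure set T -> \bar R}) (f : T -> T).
Hypothesis mf : measurable_fun [set: T] f.
Hypothesis f_inv : forall A, measurable A -> pushforward mu f A = mu A.

(** A measurable cover of [X] pulls back to a cover of its preimage with the same total measure. *)
Lemma mu_ext_preimage_le (X : set T) : (mu^* (f @^-1` X) <= mu^* X)%mu%E.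
Proof.
apply: le_ereal_inf_tmp => _ [F [mF XF] <-].
apply: ereal_inf_lbound; exists (fun k => f @^-1` F k).
  split=> [k|]; first by rewrite -[X in measurable X]setTI; exact: mf.
  by rewrite -preimage_bigcup; exact: preimage_subset.
by apply: eq_eseriesr => k _; exact: f_inv.
Qed.

Hypothesis fK : involutive f.

Let preimageK : cancel (preimage f) (preimage f).
Proof.
by move=> X; rewrite -comp_preimage (_ : f \o f = id)//; apply/funext => x /=.
Qed.

Lemma mu_ext_preimage (X : set T) : (mu^* (f @^-1` X) = mu^* X)%mu.
Proof.
apply/eqP; rewrite eq_le mu_ext_preimage_le/=.
apply: le_trans (mu_ext_preimage_le _).
by rewrite preimageK.
Qed.

(** As the outer measure is invariant, testing the preimage of [A] against [X] in the Caratheodory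
    condition amounts to testing [A] against the preimage of [X]. *)
Lemma measurable_completion :
  measurable_fun [set: caratheodory_type mu^*%mu]
    (f : caratheodory_type mu^*%mu -> caratheodory_type mu^*%mu).
Proof.
move=> _ A mA; rewrite setTI.
have cA : (mu^*%mu).-caratheodory A by exact: mA.
suff : (mu^*%mu).-caratheodory (f @^-1` A) by exact.
move=> X; set Y := f @^-1` X.
have -> : X = f @^-1` Y by rewrite preimageK.
rewrite mu_ext_preimage (cA Y).
by rewrite -(mu_ext_preimage (Y `&` A)) -(mu_ext_preimage (Y `&` ~` A)).
Qed.

Local Notation cmu := (@completed_measure_extension _ _ _ mu).

Lemma ge0_integral_completion_involution (g : T -> \bar R) :
    measurable_fun [set: caratheodory_type mu^*%mu] g ->
    (forall x, (0 <= g x)%E) ->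
  (\int[cmu]_x g (f x) = \int[cmu]_x g x)%E.
Proof.
move=> mg g0.
pose mphi := isMeasurableFun.Build _ _ _ _ _ measurable_completion.
pose phi : {mfun caratheodory_type mu^*%mu >-> caratheodory_type mu^*%mu} :=
  HB.pack f mphi.
transitivity (\int[pushforward cmu phi]_x g x)%E.
  by rewrite (ge0_integral_pushforward measurable_completion).
by apply: eq_measure_integral => A mA _; exact: mu_ext_preimage.
Qed.

End completion.

(** * The action of the transposition (0 1) *)

Section swap01.
Context (R : realType) (m : nat).
Implicit Types w : m.+1.-tuple R.

(** Index [ord0] holds w_1, which is replaced by w_0; by [sum_swap01] the new w_0 is the old w_1. *)
Definition swap01 w : m.+1.-tuple R :=
  [tuple of - (\sum_(j < m.+1) tnth w j) :: behead w].

Lemma swap01_0 w : tnth (swap01 w) ord0 = - \sum_(j < m.+1) tnth w j.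
Proof. by []. Qed.

Lemma swap01_lift w (i : 'I_m) :
  tnth (swap01 w) (lift ord0 i) = tnth w (lift ord0 i).
Proof. by rewrite tnthS [in RHS](tuple_eta w) tnthS. Qed.

Lemma sum_swap01 w : \sum_(j < m.+1) tnth (swap01 w) j = - tnth w ord0.
Proof.
rewrite big_ord_recl swap01_0 big_ord_recl.
under [X in _ + X]eq_bigr do rewrite swap01_lift.
by rewrite opprD addrNK.
Qed.

Lemma swap01K : involutive swap01.
Proof.
move=> w; apply: eq_from_tnth => i.
case: (unliftP ord0 i) => [j ->|->]; first by rewrite !swap01_lift.
by rewrite swap01_0 sum_swap01 opprK.
Qed.

Lemma mx_act_rho_tperm w :
  mx_act (rho (tperm ord0 (lift ord0 ord0)))^T w = swap01 w.
Proof.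
apply: eq_from_tnth => i; rewrite tnth_mktuple.
(* Entry (i, l) of the transpose comes from the unit vector e_i: the subtracted first coordinate is
   1 exactly for i = [ord0]. So row [ord0] is constantly -1 and the other rows are those of the
   identity. *)
under eq_bigr do rewrite !mxE !tnth_mktuple tpermV tpermL tnthS tnth_mktuple.
case: (unliftP ord0 i) => [j ->|->].
  rewrite swap01_lift (bigD1 (lift ord0 j))//= big1 ?addr0 => [|l lj].
    by rewrite tpermD// tnthS tnth_mktuple eqxx subr0 mul1r.
  rewrite subr0; case: (unliftP ord0 l) lj => [l' ->|->] lj.
    by rewrite tpermD// tnthS tnth_mktuple (negbTE lj) mul0r.
  by rewrite tpermR tnth0 mul0r.
rewrite swap01_0 -sumrN; apply: eq_bigr => l _.
case: (unliftP ord0 l) => [l' ->|->].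
  by rewrite tpermD// tnthS tnth_mktuple /= sub0r mulN1r.
by rewrite tpermR tnth0 sub0r mulN1r.
Qed.

End swap01.

(** * Invariance of Lebesgue measure under the exchange *)

Section lebesgue_Rn.
Context (R : realType).

Lemma measurable_swap01 (m : nat) :
  measurable_fun [set: m.+1.-tuple (measurableTypeR R)]
    (@swap01 R m : _ -> m.+1.-tuple (measurableTypeR R)).
Proof.
apply: (measurable_cons _ (@measurable_behead _ (measurableTypeR R) m)).
by apply/measurable_funN/measurable_sum => i; exact: measurable_tnth.
Qed.

(* With the other coordinates fixed, [swap01] is the reflection [x |-> c - x]
   of the first one. *)
Lemma borel_lebesgue_swap01 (m : nat)
    (A : set (m.+1.-tuple (measurableTypeR R))) :
  measurable A ->
  pushforward (borel_lebesgue R m.+1) (@swap01 R m) A =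
  borel_lebesgue R m.+1 A.
Proof.
move=> mA.
pose f (p : measurableTypeR R * m.-tuple (measurableTypeR R)) :
  measurableTypeR R := - (\sum_(j < m) tnth p.2 j) - p.1.
have mf : measurable_fun setT f.
  apply: measurable_funB; last exact: measurable_fst.
  apply/measurable_funN/measurable_sum => i.
  by apply: (measurableT_comp (measurable_tnth i)); exact: measurable_snd.
have swapE p : swap01 (cons_pair p) = cons_pair (f p, p.2).
  apply: eq_from_tnth => i; case: (unliftP ord0 i) => [j ->|->].
    by rewrite swap01_lift !tnthS.
  rewrite swap01_0 big_ord_recl /f opprD addrC; congr (- _ - _).
  by apply: eq_bigr => j _; rewrite tnthS.
have mB : measurable (cons_pair @^-1` A).
  by rewrite -[X in measurable X]setTI; exact: measurable_cons_pair.
rewrite /borel_lebesgue /= /pushforward /cons_measure /pushforward.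
rewrite -[RHS](@product_measure_skew _ _ _ _ _ _ _ f mf _ _ mB).
  rewrite /pushforward; congr (product_measure1 _ _ _).
  by apply/seteqP; split => p /=; rewrite swapE.
move=> y B; exact: (@lebesgue_measure_reflection R (- \sum_(j < m) tnth y j)).
Qed.

Lemma ge0_integral_swap01 (m : nat) (g : m.+1.-tuple R -> \bar R) :
    measurable_fun [set: Rn R m.+1] g -> (forall w, (0 <= g w)%E) ->
  (\int[lebesgue_Rn R m.+1]_w g (swap01 w) =
   \int[lebesgue_Rn R m.+1]_w g w)%E.
Proof.
move=> mg g0; apply: (@ge0_integral_completion_involution _ _ _
  (borel_lebesgue R m.+1) (@swap01 R m)) => //.
- exact: measurable_swap01.
- exact: borel_lebesgue_swap01.
- exact: swap01K.
Qed.

Lemma measurable_tnth_Rn (n : nat) (j : 'I_n) :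
  measurable_fun [set: Rn R n] (fun w : n.-tuple R => tnth w j).
Proof.
move=> _ B mB; rewrite setTI.
apply: (lebesgue_Rn_borel (A := (fun w => tnth w j) @^-1` B) _).1.
by rewrite -[X in measurable X]setTI; exact: measurable_tnth.
Qed.

End lebesgue_Rn.

(** * Integrals of nonnegative real functions *)

Section real_integral.
Context (d : measure_display) (T : measurableType d) (R : realType).
Variable mu : {measure set T -> \bar R}.

Lemma ge0_integralZl_real (c : R) (f : T -> R) : 0 <= c ->
    measurable_fun [set: T] f -> (forall x, 0 <= f x) ->
  (\int[mu]_x (c * f x)%:E = c%:E * \int[mu]_x (f x)%:E)%E.
Proof.
move=> c0 mf f0; under eq_integral do rewrite EFinM.
by rewrite ge0_integralZl_EFin//;
  [move=> x _; rewrite lee_fin|exact/measurable_EFinP].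
Qed.

Lemma ge0_integralD_real (f g : T -> R) :
    measurable_fun [set: T] f -> (forall x, 0 <= f x) ->
    measurable_fun [set: T] g -> (forall x, 0 <= g x) ->
  (\int[mu]_x (f x + g x)%:E =
   \int[mu]_x (f x)%:E + \int[mu]_x (g x)%:E)%E.
Proof.
move=> mf f0 mg g0; under eq_integral do rewrite EFinD.
by rewrite ge0_integralD//;
  first [exact/measurable_EFinP|move=> x _; rewrite lee_fin].
Qed.

Lemma ge0_integral_sumZD (c : R) (n : nat) (f : 'I_n -> T -> R) (g : T -> R) :
    0 <= c ->
    (forall i, measurable_fun [set: T] (f i)) -> (forall i x, 0 <= f i x) ->
    measurable_fun [set: T] g -> (forall x, 0 <= g x) ->
  (\int[mu]_x (c * (\sum_(i < n) f i x + g x))%:E =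
   c%:E * (\sum_(i < n) \int[mu]_x (f i x)%:E + \int[mu]_x (g x)%:E))%E.
Proof.
move=> c0 mf f0 mg g0.
have msum : measurable_fun [set: T] (fun x => \sum_(i < n) f i x).
  exact: measurable_sum.
have sum0 x : 0 <= \sum_(i < n) f i x by apply: sumr_ge0.
rewrite ge0_integralZl_real//; last 2 first.
- exact: measurable_funD.
- by move=> x; rewrite addr_ge0.
rewrite ge0_integralD_real//; under eq_integral do rewrite -sumEFin.
rewrite ge0_integral_sum// => [i|i x _].
  by apply/measurable_EFinP; exact: mf.
by rewrite lee_fin.
Qed.

Lemma Lnorm2E (f : T -> R) :
  ('N[mu]_2%:E[EFin \o f] = (\int[mu]_x (f x ^+ 2)%:E) `^ 2^-1)%E.
Proof.
rewrite unlock; congr (_ `^ _)%E; apply: eq_integral => x _ /=.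
by rewrite powR_mulrn// real_normK// num_real.
Qed.

End real_integral.

(** * Minimality of the truncated kernel, for an abstract weight [q] *)

Section truncated_kernel.
Context (d : measure_display) (T : measurableType d) (R : realType).
Variables (mu : {measure set T -> \bar R}) (q : T -> R) (a b : R).
Hypotheses (mq : measurable_fun [set: T] q) (q_ge0 : forall x, 0 <= q x).
Hypotheses (a_gt0 : 0 < a) (b_gt0 : 0 < b).

Let f x := Num.max (a * (1 - b * q x)) 0.

Let mf : measurable_fun [set: T] f.
Proof.
apply: measurable_maxr => //; apply: measurable_funM => //.
by apply: measurable_funB => //; exact: measurable_funM.
Qed.

Let f_ge0 x : 0 <= f x. Proof. by rewrite le_max lexx orbT. Qed.

Let ab2_gt0 : 0 < 2 * a * b. Proof. by rewrite !mulr_gt0. Qed.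

(** Stated for any [g] because it is applied both to the competitor and to [f] itself. *)
Let integral_weighted (g : T -> R) :
    measurable_fun [set: T] g -> (forall x, 0 <= g x) ->
  (\int[mu]_x (g x ^+ 2 + (f x ^+ 2 + 2 * a * b * (q x * g x)))%:E =
   \int[mu]_x (g x ^+ 2)%:E + (\int[mu]_x (f x ^+ 2)%:E +
     (2 * a * b)%:E * \int[mu]_x (q x * g x)%:E))%E.
Proof.
move=> mg g_ge0.
have mqg : measurable_fun [set: T] (fun x => q x * g x).
  exact: measurable_funM.
have qg_ge0 x : 0 <= q x * g x by rewrite mulr_ge0.
have mcqg : measurable_fun [set: T] (fun x => 2 * a * b * (q x * g x)).
  exact: measurable_funM.
have cqg_ge0 x : 0 <= 2 * a * b * (q x * g x) by rewrite mulr_ge0// ltW.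
have mg2 := measurable_funX 2 mg; have mf2 := measurable_funX 2 mf.
rewrite ge0_integralD_real//; last 3 first.
- by move=> x; exact: sqr_ge0.
- exact: measurable_funD.
- by move=> x; rewrite addr_ge0// sqr_ge0.
rewrite ge0_integralD_real//; last by move=> x; exact: sqr_ge0.
by rewrite ge0_integralZl_real// ltW.
Qed.

(* Every term of [2 a g <= g^2 + f^2 + 2 a b q g] is nonnegative, so it can be
   integrated without assuming [g^2] integrable. *)
Lemma truncated_minimizes_square_integral (g : T -> R) :
    measurable_fun [set: T] g -> (forall x, 0 <= g x) ->
    (\int[mu]_x (f x)%:E = 1)%E -> (\int[mu]_x (g x)%:E = 1)%E ->
    (\int[mu]_x (q x * g x)%:E = \int[mu]_x (q x * f x)%:E)%E ->
  (\int[mu]_x (f x ^+ 2)%:E <= \int[mu]_x (g x ^+ 2)%:E)%E.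
Proof.
move=> mg g_ge0 f1 g1 qgf.
have a2_ge0 : 0 <= 2 * a by rewrite mulr_ge0// ltW.
have eqf := integral_weighted mf f_ge0.
have leg : ((2 * a)%:E <=
    \int[mu]_x (g x ^+ 2 + (f x ^+ 2 + 2 * a * b * (q x * g x)))%:E)%E.
  rewrite -[leLHS]mule1 -g1 -ge0_integralZl_real//.
  apply: ge0_le_integral => //=.
  - by move=> x _; rewrite lee_fin mulr_ge0.
  - by apply/measurable_EFinP; exact: measurable_funM.
  - apply/measurable_EFinP; apply: measurable_funD.
      exact: measurable_funX.
    apply: measurable_funD; first exact: measurable_funX.
    by apply: measurable_funM => //; exact: measurable_funM.
  (* The difference of the two sides is g^2 - 2 g a (1 - b q) where the factor a (1 - b q) is
     negative and f = 0, and (g - f)^2 elsewhere. *)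
  move=> x _; rewrite lee_fin /f; case: (ltP (a * (1 - b * q x)) 0) => h.
    rewrite expr0n/= add0r -subr_ge0.
    have := mulr_ge0_le0 (g_ge0 x) (ltW h); have := sqr_ge0 (g x); lra.
  rewrite -subr_ge0.
  have := sqr_ge0 (g x - a * (1 - b * q x)); nra.
rewrite integral_weighted// qgf in leg.
(* For g = f the inequality is an equality: f is 0 or a (1 - b q), so 2 f^2 + 2 a b q f = 2 a f. *)
have {}eqf : (\int[mu]_x (f x ^+ 2)%:E + (\int[mu]_x (f x ^+ 2)%:E +
    (2 * a * b)%:E * \int[mu]_x (q x * f x)%:E) = (2 * a)%:E)%E.
  rewrite -eqf -[RHS]mule1 -f1 -ge0_integralZl_real//.
  apply: eq_integral => x _; congr EFin; rewrite /f; case: ltP => _.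
    by ring.
  by ring.
(* Cancelling the common summand requires it to be finite; it is, as part of a sum equal to 2 a. *)
rewrite -eqf leeD2rE// in leg.
have := erefl ((2 * a)%:E \is a fin_num); rewrite -{1}eqf.
by rewrite !fin_numD => /andP[_ ->].
Qed.

End truncated_kernel.

(** * The quadratic form and its integral *)

Section form.
Context (R : realType).

(** Copies the bracket of [Lambda_opt_tilde], so that [Lambda_opt] is by conversion the truncated
    kernel with this weight. *)
Definition quad_form (n : nat) (w : n.-tuple R) : R :=
  \sum_(i < n) tnth w i ^+ 2 +
  \sum_(i < n) \sum_(j < n | (i < j)%N) tnth w i * tnth w j.

(** The squared sum is w_0^2, which makes both the nonnegativity and the symmetry in w_0, ..., w_n
    visible. *)
Lemma quad_formE (n : nat) (w : n.-tuple R) :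
  quad_form w =
  2^-1 * (\sum_(i < n) tnth w i ^+ 2 + (\sum_(i < n) tnth w i) ^+ 2).
Proof.
set s := \sum_(i < n) \sum_(j < n | (i < j)%N) tnth w i * tnth w j.
have -> : (\sum_(i < n) tnth w i) ^+ 2 = \sum_(i < n) tnth w i ^+ 2 + s + s.
  (* One copy of [s] is turned into the sum below the diagonal; with the other copy and the diagonal
     it covers all pairs. *)
  have {2}-> : s = \sum_(i < n) \sum_(j < n | (j < i)%N) tnth w i * tnth w j.
    rewrite [RHS](exchange_big_dep xpredT)//=; apply: eq_bigr => i _.
    by apply: eq_bigr => j _; rewrite mulrC.
  rewrite expr2 mulr_suml -!big_split/=; apply: eq_bigr => i _.
  rewrite mulr_sumr (bigD1 i)//= (bigID (fun j : 'I_n => (i < j)%N))/=.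
  rewrite addrA expr2.
  congr (_ + _ + _); apply: eq_bigl => j; rewrite -(inj_eq val_inj).
    by case: ltngtP.
  by case: ltngtP.
by rewrite /quad_form -/s; field.
Qed.

Lemma quad_form_ge0 (n : nat) (w : n.-tuple R) : 0 <= quad_form w.
Proof.
rewrite quad_formE mulr_ge0 ?invr_ge0// addr_ge0 ?sqr_ge0//.
by apply: sumr_ge0 => i _; exact: sqr_ge0.
Qed.

Lemma quad_form_swap01 (m : nat) (w : m.+1.-tuple R) :
  quad_form (swap01 w) = quad_form w.
Proof.
rewrite !quad_formE sum_swap01 sqrrN.
rewrite [X in _ * (X + _)]big_ord_recl swap01_0 sqrrN.
under [X in _ * (_ + X + _)]eq_bigr do rewrite swap01_lift.
by rewrite [X in _ = _ * (X + _)]big_ord_recl; ring.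
Qed.

Lemma measurable_sum_tnth (n : nat) :
  measurable_fun [set: Rn R n] (fun w : n.-tuple R => \sum_(i < n) tnth w i).
Proof.
by apply: (@measurable_sum _ (Rn R n) R) => i; exact: measurable_tnth_Rn.
Qed.

Lemma measurable_quad_form (n : nat) :
  measurable_fun [set: Rn R n] (@quad_form n).
Proof.
rewrite (_ : @quad_form n = fun w => 2^-1 *
    (\sum_(i < n) tnth w i ^+ 2 + (\sum_(i < n) tnth w i) ^+ 2)); last first.
  by apply/funext => w; exact: quad_formE.
apply: (@measurable_funM _ (Rn R n) R).
  exact: measurable_cst.
apply: (@measurable_funD _ (Rn R n) R).
  apply: (@measurable_sum _ (Rn R n) R) => i.
  apply: (@measurable_funX _ (Rn R n) R).
  exact: measurable_tnth_Rn.
by apply: (@measurable_funX _ (Rn R n) R); exact: measurable_sum_tnth.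
Qed.

(** Only moments of coordinates remain on the right, so kernels with equal moments get equal
    integrals. *)
Lemma integral_quad_form (m : nat) (g : m.+1.-tuple R -> R) :
    measurable_fun [set: Rn R m.+1] g -> (forall w, 0 <= g w) ->
    (forall w, g (swap01 w) = g w) ->
  (\int[lebesgue_Rn R m.+1]_w (quad_form w * g w)%:E =
   2^-1%:E *
    (\sum_(i < m.+1) \int[lebesgue_Rn R m.+1]_w (tnth w i ^+ 2 * g w)%:E +
     \int[lebesgue_Rn R m.+1]_w (tnth w ord0 ^+ 2 * g w)%:E))%E.
Proof.
move=> mg g_ge0 g_sym.
pose h i (w : Rn R m.+1) : R := tnth (w : m.+1.-tuple R) i ^+ 2 * g w.
have mh i : measurable_fun [set: Rn R m.+1] (h i).
  apply: (@measurable_funM _ (Rn R m.+1) R); last exact: mg.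
  by apply: (@measurable_funX _ (Rn R m.+1) R); exact: measurable_tnth_Rn.
have h_ge0 i w : 0 <= h i w by rewrite mulr_ge0 ?sqr_ge0.
pose k (w : Rn R m.+1) : R :=
  (\sum_(j < m.+1) tnth (w : m.+1.-tuple R) j) ^+ 2 * g w.
have mk : measurable_fun [set: Rn R m.+1] k.
  apply: (@measurable_funM _ (Rn R m.+1) R); last exact: mg.
  by apply: (@measurable_funX _ (Rn R m.+1) R); exact: measurable_sum_tnth.
have k_ge0 w : 0 <= k w by rewrite mulr_ge0 ?sqr_ge0.
(* The moments of w_1^2 and w_0^2 agree, by the change of variables [swap01] and the symmetry of
   [g]. *)
have -> : (\int[lebesgue_Rn R m.+1]_w (tnth w ord0 ^+ 2 * g w)%:E =
    \int[lebesgue_Rn R m.+1]_w (k w)%:E)%E.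
  rewrite -(@ge0_integral_swap01 R m (EFin \o h ord0)).
  - by apply: eq_integral => w _; rewrite /= /h /k g_sym swap01_0 sqrrN.
  - by apply/measurable_EFinP; exact: mh.
  - by move=> w; rewrite lee_fin; exact: h_ge0.
have half_ge0 : 0 <= 2^-1 :> R by rewrite invr_ge0.
rewrite -(ge0_integral_sumZD (lebesgue_Rn R m.+1) half_ge0 mh h_ge0 mk k_ge0).
apply: eq_integral => w _; congr EFin.
by rewrite quad_formE /h /k -mulr_suml; ring.
Qed.

End form.

(* k = n.+1 *)
Theorem theorem3 (R : realType) (n : nat) (hk : (2 <= n.+1)%N)
  (beta alpha : R) (hbeta : 0 < beta) (halpha : 0 < alpha)
  (hopt : (\int[lebesgue_Rn R n]_w (Lambda_opt alpha beta w)%:E = 1)%E)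
  (Lambda : n.-tuple R -> R)
  (Lambda_meas : measurable_fun [set: Rn R n] Lambda)
  (Lambda_ge0 : forall w, 0 <= Lambda w)
  (Lambda_int1 : (\int[lebesgue_Rn R n]_w (Lambda w)%:E = 1)%E)
  (Lambda_sym : forall (s : 'S_n.+1) (w : n.-tuple R),
     Lambda w = Lambda (mx_act (rho s)^T w))
  (Lambda_moments : forall j : 'I_n,
     (\int[lebesgue_Rn R n]_w (tnth w j ^+ 2 * Lambda w)%:E =
      \int[lebesgue_Rn R n]_w (tnth w j ^+ 2 * Lambda_opt alpha beta w)%:E)%E) :
  ('N[lebesgue_Rn R n]_2%:E[EFin \o Lambda_opt alpha beta]
     <= 'N[lebesgue_Rn R n]_2%:E[EFin \o Lambda])%E /\
  (\int[lebesgue_Rn R n]_w (Lambda_opt alpha beta w ^+ 2)%:E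
     <= \int[lebesgue_Rn R n]_w (Lambda w ^+ 2)%:E)%E.
Proof.
have le2 : (\int[lebesgue_Rn R n]_w (Lambda_opt alpha beta w ^+ 2)%:E
    <= \int[lebesgue_Rn R n]_w (Lambda w ^+ 2)%:E)%E.
  (* [hk] rules out n = 0, so there is a w_1 to exchange with w_0. *)
  case: n => [//|m] in hk hopt Lambda Lambda_meas Lambda_ge0 Lambda_int1
    Lambda_sym Lambda_moments *.
  have mq := @measurable_quad_form R m.+1.
  have opt_ge0 w : 0 <= Lambda_opt alpha beta w :> R.
    by rewrite /Lambda_opt le_max lexx orbT.
  have opt_meas : measurable_fun [set: Rn R m.+1] (Lambda_opt alpha beta).
    apply: (@measurable_maxr _ (Rn R m.+1) R); last exact: measurable_cst.
    apply: (@measurable_funM _ (Rn R m.+1) R); first exact: measurable_cst.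
    apply: (@measurable_funB _ (Rn R m.+1) R); first exact: measurable_cst.
    by apply: (@measurable_funM _ (Rn R m.+1) R); first exact: measurable_cst.
  apply: (truncated_minimizes_square_integral mq (@quad_form_ge0 R m.+1)
    halpha hbeta Lambda_meas) => //.
  rewrite !integral_quad_form//.
  - by congr (_ * (_ + _))%E; [apply: eq_bigr => i _|]; exact: Lambda_moments.
  - exact: opt_ge0.
  - by move=> w; rewrite quad_form_swap01.
  (* The symmetry hypothesis is used for the transposition (0 1). *)
  - by move=> w; rewrite -mx_act_rho_tperm -Lambda_sym.
split=> //.
(* The norms are square roots of these integrals, and the root is monotone on [0, +oo], so infinite
   norms are covered. *)
rewrite !Lnorm2E; apply: gt0_ler_poweR => //.
- by rewrite in_itv/= leey andbT integral_ge0// => w _; rewrite lee_fin sqr_ge0.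
- by rewrite in_itv/= leey andbT integral_ge0// => w _; rewrite lee_fin sqr_ge0.
Qed.
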